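(* Let $A_k<0<B_k$ ($k=1,\dots,n$) be real numbers and let $\phi=\{\phi_k: k=1,2,\dots,n\}$ be a system of real random variables on a probability space satisfying $A_k\le\phi_k\le B_k$ for all $k$. Then for every $\lambda>0$, $$\left|\left\{\sum_{k=1}^n\phi_k>\lambda\right\}\right|\le (1+\mu(\phi,\mathfrak{M}_n))\exp\left(-\frac{2\lambda^2}{\sum_{k=1}^n(B_k-A_k)^2}\right).$$
   Context: $|\{\cdot\}|$ denotes the probability of an event. $\mathfrak{M}_n$ is the family of all nonempty subsets of $\{1,2,\dots,n\}$. With $C_k=\min\{-A_k,B_k\}$, the multiplicative error is $$\mu(\phi,\mathfrak{M}_n)=\sum_{\{n_1,\dots,n_\nu\}\in\mathfrak{M}_n}\frac{1}{C_{n_1}C_{n_2}\cdots C_{n_\nu}}\left|\mathbf{E}[\phi_{n_1}\phi_{n_2}\cdots\phi_{n_\nu}]\right|.$$ *)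

(* Defs.v *)
From HB Require Import structures.
From mathcomp Require Export all_boot all_order all_algebra.
From mathcomp Require Export all_classical all_reals all_analysis.
Set Implicit Arguments.
Unset Strict Implicit.
Unset Printing Implicit Defensive.
Import Order.TTheory GRing.Theory Num.Theory.
Import numFieldNormedType.Exports.

Local Open Scope classical_set_scope.
Local Open Scope ring_scope.

Definition cmin (R : realType) (n : nat) (A B : 'I_n -> R) (k : 'I_n) : R :=
  Num.min (- A k) (B k).

(* The index set {1, ..., n} is represented by 'I_n.  The value lies in \bar R
   because the library's expectation does; no finiteness convention is used. *)
Definition mult_error d (T : measurableType d) (R : realType)
    (P : probability T R) (n : nat) (A B : 'I_n -> R)
    (phi : 'I_n -> {RV P >-> R}) (M : {set {set 'I_n}}) : \bar R :=
  (\sum_(S in M)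
     ((\prod_(k in S) cmin A B k)^-1)%:E
     * `| 'E_P[(fun w => \prod_(k in S) phi k w)%R] |)%E.

Definition nonempty_subsets (n : nat) : {set {set 'I_n}} :=
  [set S : {set 'I_n} | S != finset.set0]%SET.

(* Main.v *)
(* With [C = min(-A, B)], the chord of [x |-> exp (t x)] over [[A, B]] is an
   affine function [a (1 + r x)] where [0 <= r <= 1 / C] and, by Hoeffding's
   lemma, [a <= exp (t^2 (B - A)^2 / 8)].  Multiplying these majorants over [k],
   expanding the product over subsets and taking expectations bounds
   [E (exp (t \sum phi_k))] by [(1 + mu) exp (t^2 \sum (B_k - A_k)^2 / 8)];
   Markov's inequality with [t = 4 lambda / \sum (B_k - A_k)^2] concludes. *)
Require Import Defs.
From mathcomp Require Import measurable_realfun ring lra.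
Set Implicit Arguments.
Unset Strict Implicit.
Unset Printing Implicit Defensive.
Import Order.TTheory GRing.Theory Num.Theory.
Import numFieldNormedType.Exports.
Local Open Scope classical_set_scope.
Local Open Scope ring_scope.

(** Convexity of the exponential: the tangent at [x] lies below the graph at [A] and at [B]. Adding
    these two inequalities with weights [B - x] and [x - A] cancels the first-order terms. *)
Lemma expR_le_chord (R : realType) (A B t x : R) : A <= x <= B ->
  (B - A) * expR (t * x) <= (x - A) * expR (t * B) + (B - x) * expR (t * A).
Proof.
move=> /andP[Ax xB].
have tangent y : expR (t * x) * (1 + t * (y - x)) <= expR (t * y).
  have -> : t * y = t * x + t * (y - x) by ring.
  by rewrite expRD ler_pM2l ?expR_gt0// expR_ge1Dx.
have hB : (x - A) * (expR (t * x) * (1 + t * (B - x))) <= (x - A) * expR (t * B).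
  by rewrite ler_wpM2l ?subr_ge0.
have hA : (B - x) * (expR (t * x) * (1 + t * (A - x))) <= (B - x) * expR (t * A).
  by rewrite ler_wpM2l ?subr_ge0.
apply: le_trans (lerD hB hA); rewrite le_eqVlt; apply/orP; left; apply/eqP.
ring.
Qed.

(** * Moment generating function of a Bernoulli variable *)

Section bernoulli_mgf.
Variables (R : realType) (p : R).
Hypothesis p01 : 0 < p < 1.

Let W (u : R) : R := 1 - p + p * expR u.

Let W_gt0 u : 0 < W u.
Proof. by have := expR_gt0 u; move: p01; rewrite /W; nra. Qed.

Let derive_tilted_mean (u : R) : is_derive u 1
  (fun v => v / 4 + p - p * expR v / W v) (4^-1 - p * (1 - p) * expR u / W u ^+ 2).
Proof.
have Wn0 : W u != 0 by rewrite gt_eqF.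
rewrite /W in Wn0 *.
apply: is_derive_eq.
rewrite /GRing.scale /=.
by field.
Qed.

(* The derivative of the right minus the left side (after division by [W]) is
   [1/4 - s (1 - s)], where [s] is the mean of the tilted Bernoulli law. *)
Lemma tilted_mean_le (u : R) : 0 <= u -> p * expR u <= (u / 4 + p) * W u.
Proof.
move=> u0; rewrite -ler_pdivrMr ?W_gt0// -subr_ge0.
have := @ger0_derive1_ndecry R (fun v => v / 4 + p - p * expR v / W v) 0
  _ _ _ 0 u (lexx _) u0.
rewrite /W expR0 mul0r add0r mulr1 subrK divr1 subrr; apply.
- by move=> x _; have [] := derive_tilted_mean x.
- move=> x _; have D := derive_tilted_mean x; rewrite derive1E derive_val subr_ge0.
  have W2 : 0 < W x ^+ 2 by rewrite exprn_gt0// W_gt0.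
  rewrite (ler_pdivrMr _ _ W2) /W.
  have := expR_gt0 x; set e := expR x => e0.
  (* Cleared of denominators, the bound is [4 (1 - p) (p e) <= (1 - p + p e)^2]. *)
  have := sqr_ge0 (1 - p - p * e); nra.
- apply: continuous_subspaceT => x.
  apply: differentiable_continuous; apply/derivable1_diffP.
  by have [] := derive_tilted_mean x.
Qed.

Let derive_scaled_mgf (u : R) : is_derive u 1
  (fun v => W v * expR (- (v ^+ 2 / 8 + p * v)))
  ((p * expR u - (u / 4 + p) * W u) * expR (- (u ^+ 2 / 8 + p * u))).
Proof.
rewrite /W.
apply: is_derive_eq.
rewrite /GRing.scale /=.
by field.
Qed.

(** The quotient of the two sides is 1 at 0, and [tilted_mean_le] says that its derivative is
    nonpositive on the half-line. *)
Lemma bernoulli_mgf_le (u : R) : 0 <= u ->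
  1 - p + p * expR u <= expR (u ^+ 2 / 8 + p * u).
Proof.
move=> u0; rewrite -[leRHS]mul1r -ler_pdivrMr ?expR_gt0// -expRN.
have := @ler0_derive1_nincry R
  (fun v => W v * expR (- (v ^+ 2 / 8 + p * v))) 0 _ _ _ 0 u (lexx _) u0.
rewrite [W 0]/W !expR0 !expr0n/= mul0r mulr0 addr0 oppr0 !expR0 !mulr1 subrK; apply.
- by move=> x _; have [] := derive_scaled_mgf x.
- move=> x; rewrite in_itv/= andbT => /ltW x0.
  have D := derive_scaled_mgf x; rewrite derive1E derive_val.
  by rewrite mulr_le0_ge0 ?expR_ge0// subr_le0 tilted_mean_le.
- apply: continuous_subspaceT => x.
  apply: differentiable_continuous; apply/derivable1_diffP.
  by have [] := derive_scaled_mgf x.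
Qed.

End bernoulli_mgf.

(** Divided by [B - A], the left side is the mean of [exp (t X)] for the centred law on [{A, B}],
    with mass [p = - A / (B - A)] at [B]. Factoring out [exp (t A)] leaves the Bernoulli case at
    [u = t (B - A)], where [p u = - t A] cancels this factor. *)
Lemma hoeffding_intercept_le (R : realType) (A B t : R) : A < 0 -> 0 < B -> 0 < t ->
  B * expR (t * A) - A * expR (t * B) <=
  (B - A) * expR (t ^+ 2 * (B - A) ^+ 2 / 8).
Proof.
move=> A0 B0 t0; have D0 : 0 < B - A by lra.
have Dn0 : B - A != 0 by rewrite gt_eqF.
have p01 : 0 < - A / (B - A) < 1.
  by apply/andP; split; [rewrite divr_gt0//; lra|rewrite ltr_pdivrMr//; lra].
have u0 : 0 <= t * (B - A) by rewrite mulr_ge0 ?ltW.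
have := bernoulli_mgf_le p01 u0.
have eA : 0 < expR (t * A) * (B - A) by rewrite mulr_gt0 ?expR_gt0.
rewrite -(ler_pM2l eA) => h; apply: le_trans (le_trans h _); rewrite le_eqVlt.
  have -> : expR (t * B) = expR (t * A) * expR (t * (B - A)).
    by rewrite -expRD; congr expR; ring.
  by apply/orP; left; apply/eqP; field.
apply/orP; left; apply/eqP; rewrite mulrAC mulrC -expRD; congr (_ * expR _).
by field.
Qed.

Lemma expR_le_affine (R : realType) (A B t : R) : A < 0 -> 0 < B -> 0 < t ->
  exists r, 0 <= r <= (Num.min (- A) B)^-1 /\ forall x, A <= x <= B ->
    expR (t * x) <= expR (t ^+ 2 * (B - A) ^+ 2 / 8) * (1 + r * x).
Proof.
move=> A0 B0 t0; have D0 : 0 < B - A by lra.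
have eA : 0 < expR (t * A) := expR_gt0 _.
have eB : 0 < expR (t * B) := expR_gt0 _.
have eAB : expR (t * A) <= expR (t * B) by rewrite ler_expR ler_pM2l//; lra.
have hE := hoeffding_intercept_le A0 B0 t0.
set a := B * expR (t * A) - A * expR (t * B) in hE.
have a0 : 0 < a by rewrite /a; nra.
(* Slope of the chord over its value at 0; both are scaled by [B - A]. *)
exists ((expR (t * B) - expR (t * A)) / a); split.
  apply/andP; split; first by rewrite divr_ge0 ?(ltW a0)// subr_ge0.
  have C0 : 0 < Num.min (- A) B by rewrite lt_min B0 andbT; lra.
  rewrite ler_pdivrMr// [leRHS]mulrC ler_pdivlMr//.
  have : Num.min (- A) B <= - A by rewrite ge_min lexx.
  (* [a >= - A exp (t B) >= C exp (t B) >= C (exp (t B) - exp (t A))]. *)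
  set C := Num.min _ _ in C0 *; rewrite /a; nra.
move=> x Ax; rewrite -(ler_pM2l D0).
have hx := expR_le_chord t Ax.
have chordE : (x - A) * expR (t * B) + (B - x) * expR (t * A) =
    a * (1 + (expR (t * B) - expR (t * A)) / a * x).
  by rewrite /a; field; rewrite gt_eqF.
rewrite chordE in hx; apply: le_trans hx _.
rewrite [leRHS]mulrA ler_wpM2r//.
(* The factor [1 + r x] is nonnegative because [a] times it is the chord, a nonnegative combination
   of exponentials. *)
rewrite -(pmulr_rge0 _ a0) -chordE.
by move/andP: Ax => [Ax xB]; rewrite addr_ge0// mulr_ge0 ?subr_ge0 ?expR_ge0.
Qed.

(** * Expectations under almost sure bounds *)

Section almost_sure_bounds.
Context d (T : measurableType d) (R : realType) (P : probability T R).

Lemma ae_bounded_integrable (f : T -> R) (M : R) : measurable_fun setT f ->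
  {ae P, forall w, `|f w| <= M} -> P.-integrable setT (EFin \o f).
Proof.
move=> mf fM; apply/integrableP; split; first exact/measurable_EFinP.
apply: (@le_lt_trans _ _ (`|M|%:E * P setT)%E).
  apply: integral_le_bound => //; first exact/measurable_EFinP.
  apply: filterS fM => w fwM _; rewrite lee_fin (le_trans fwM)//; exact: ler_norm.
by rewrite probability_setT mule1 ltry.
Qed.

Lemma le_prob_expectation (E : set T) (g : T -> R) : measurable E ->
  measurable_fun setT g -> {ae P, forall w, \1_E w <= g w} ->
  (P E <= 'E_P[g])%E.
Proof.
move=> mE mg Eg; rewrite -expectation_indic//.
(* [g] is nonnegative only almost surely; its absolute value is nonnegative everywhere and has the
   same expectation. *)
have -> : ('E_P[g] = 'E_P[fun w => `|g w|%R])%E.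
  rewrite unlock; apply: ae_eq_integral => //.
  - exact/measurable_EFinP.
  - exact/measurable_EFinP/measurableT_comp.
  - apply: filterS Eg => w Egw _ /=; rewrite ger0_norm//.
    by apply: le_trans Egw; rewrite indicE ler0n.
apply: expectation_le => //.
- exact: measurableT_comp.
- by apply: filterS Eg => w /le_trans; apply; exact: ler_norm.
Qed.

Variables (n : nat) (A B : 'I_n -> R) (phi : 'I_n -> {RV P >-> R}).
Hypothesis hphi : forall k, {ae P, forall w, A k <= phi k w <= B k}.

Lemma ae_all_bounds : {ae P, forall w, forall k, A k <= phi k w <= B k}.
Proof. exact: filter_forall. Qed.

Lemma measurable_fun_prod_set (S : {set 'I_n}) :
  measurable_fun setT (fun w => \prod_(k in S) phi k w).
Proof.
under eq_fun do rewrite big_mkcond.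
apply: measurable_prod => k _; case: (k \in S) => //; exact: measurable_funP.
Qed.

Lemma integrable_prod_set (S : {set 'I_n}) :
  P.-integrable setT (EFin \o (fun w => \prod_(k in S) phi k w)).
Proof.
apply: (@ae_bounded_integrable _ (\prod_(k in S) (`|A k| + `|B k|))).
  exact: measurable_fun_prod_set.
apply: filterS ae_all_bounds => w hw.
rewrite normr_prod; apply: ler_prod => k _; rewrite normr_ge0/=.
have /andP[Ak kB] := hw k.
have := ler_norm (B k); have := ler_norm (- A k); rewrite normrN => ? ?.
have := normr_ge0 (A k); have := normr_ge0 (B k) => ? ?.
by rewrite ler_norml; apply/andP; split; lra.
Qed.

Lemma expectation_prod_affine (r : 'I_n -> R) (K : R) :
  ('E_P[fun w => (K * \prod_k (1 + r k * phi k w))%R] =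
  K%:E * \sum_(S : {set 'I_n})
    (\prod_(k in S) r k)%:E * 'E_P[fun w => (\prod_(k in S) phi k w)%R])%E.
Proof.
rewrite unlock.
transitivity (\int[P]_w (K%:E * \sum_(S : {set 'I_n})
    (\prod_(k in S) r k)%:E * (\prod_(k in S) phi k w)%:E))%E.
  apply: eq_integral => w _; rewrite EFinM; congr (_ * _)%E.
  under eq_bigr do rewrite addrC.
  (* Each [S] collects the indices whose factor contributes [r k * phi k w] rather than 1. *)
  rewrite (bigA_distr _ _ (fun k => r k * phi k w) (fun=> 1)) -sumEFin.
  apply: eq_bigr => S _; rewrite -big_mkcond big_split/=.
  by rewrite EFinM.
have iS (S : {set 'I_n}) : P.-integrable setT
    (fun w => (\prod_(k in S) r k)%:E * (\prod_(k in S) phi k w)%:E)%E.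
  exact: integrableZl (integrable_prod_set S).
rewrite integralZl//; last exact: integrable_sum.
congr (_ * _)%E; rewrite integral_sum//.
apply: eq_bigr => S _; rewrite integralZl//; exact: integrable_prod_set.
Qed.

End almost_sure_bounds.

Theorem theorem1p2 (d : measure_display) (T : measurableType d) (R : realType)
    (P : probability T R) (n : nat) (hn : (0 < n)%N) (A B : 'I_n -> R)
    (hA : forall k, A k < 0) (hB : forall k, 0 < B k)
    (phi : 'I_n -> {RV P >-> R})
    (hphi : forall k, {ae P, forall w, A k <= phi k w <= B k})
    (lambda : R) (hlambda : 0 < lambda) :
  (P [set w | (lambda < \sum_(k < n) phi k w)%R]
   <= (1 + mult_error A B phi (nonempty_subsets n))
      * (expR (- (2 * lambda ^+ 2 / \sum_(k < n) (B k - A k) ^+ 2)))%R%:E)%E.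
Proof.
set D := \sum_(k < n) (B k - A k) ^+ 2.
have D0 : 0 < D.
  rewrite /D (bigD1 (Ordinal hn))//= ltr_pwDl//; last first.
    by apply: sumr_ge0 => k _; exact: sqr_ge0.
  by rewrite exprn_gt0// subr_gt0 (lt_trans (hA _)).
(* This [t] minimizes the exponent [t^2 D / 8 - t lambda]; the minimum is [- 2 lambda^2 / D]. *)
pose t := 4 * lambda / D.
have t0 : 0 < t by rewrite divr_gt0// mulr_gt0.
have [r hr] := choice (fun k => expR_le_affine (hA k) (hB k) t0).
pose K := expR (- (2 * lambda ^+ 2 / D)).
have KE : expR (- (t * lambda)) * \prod_k expR (t ^+ 2 * (B k - A k) ^+ 2 / 8) = K.
  rewrite -expR_sum -mulr_suml -mulr_sumr -/D -expRD /K; congr expR.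
  by rewrite /t; field; rewrite gt_eqF.
have mphi : measurable_fun setT (fun w => \sum_(k < n) phi k w).
  by apply: measurable_sum => k; exact: measurable_funP.
have mE : measurable [set w | (lambda < \sum_(k < n) phi k w)%R].
  have := mphi measurableT _ (measurable_itv `]lambda, +oo[).
  rewrite setTI; congr measurable; apply/seteqP.
  by split=> w /=; rewrite in_itv/= andbT.
apply: (@le_trans _ _ 'E_P[fun w => (K * \prod_k (1 + r k * phi k w))%R]%E).
  apply: le_prob_expectation => //.
    apply: measurable_funM => //; apply: measurable_prod => k _.
    apply: measurable_funD => //; apply: measurable_funM => //; exact: measurable_funP.
  apply: filterS (ae_all_bounds hphi) => w hw.
  have mgf_le : expR (t * \sum_k phi k w) <=
      \prod_k expR (t ^+ 2 * (B k - A k) ^+ 2 / 8) * \prod_k (1 + r k * phi k w).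
    rewrite mulr_sumr expR_sum -big_split/=; apply: ler_prod => k _.
    by rewrite expR_ge0/=; have [_ ->] := hr k.
  (* Markov's inequality in pointwise form: the indicator is at most [exp (t (sum - lambda))]. *)
  apply: le_trans (_ : expR (- (t * lambda)) * expR (t * \sum_k phi k w) <= _).
    rewrite indicE; case: (boolP (w \in _)) => [|_]; last first.
      by rewrite mulr_ge0 ?expR_ge0.
    rewrite inE/= => lt; rewrite -expRD -expR0 ler_expR.
    by rewrite addrC subr_ge0 ler_pM2l// ltW.
  by rewrite -KE -mulrA ler_pM2l ?expR_gt0.
rewrite (expectation_prod_affine hphi) [leRHS]muleC.
apply: lee_wpmul2l; first by rewrite lee_fin expR_ge0.
(* The empty set gives the summand 1; the nonempty sets are compared with [mult_error] term by
   term. *)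
rewrite (bigD1 finset.set0)//=; apply: leeD.
  rewrite big_set0 mul1e.
  have -> : (fun w => \prod_(k in finset.set0) phi k w) = cst 1.
    by apply/funext => w; rewrite big_set0.
  by rewrite expectation_cst.
rewrite /mult_error [leRHS](eq_bigl (fun S => S != finset.set0)); last first.
  by move=> S; rewrite inE.
apply: lee_sum => S _.
have r0 k : 0 <= r k by have [/andP[]] := hr k.
apply: (@le_trans _ _ ((\prod_(k in S) r k)%:E *
    `|'E_P[fun w => (\prod_(k in S) phi k w)%R]|)%E).
  by apply: lee_wpmul2l; [rewrite lee_fin prodr_ge0|exact: lee_abs].
apply: lee_wpmul2r; first exact: abse_ge0.
rewrite lee_fin -prodfV; apply: ler_prod => k _; rewrite r0/=.
by have [/andP[]] := hr k.
Qed.
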